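(* Let $(R,\mathfrak m,k)$ be an $F$-finite reduced Noetherian local ring of prime characteristic $p$. Then, for every $e$, $A_e(R)=\{c\in R: \phi_{c,e}\text{ does not split over }R\}$, and $\mathcal P(R)$ is a prime ideal or the unit ideal.
   Context: All rings are commutative and Noetherian; $q=p^e$. For a reduced ring $R$ of characteristic $p$, $R^{1/q}$ is the ring of $q$-th roots of elements of $R$; $R$ is $F$-finite if $R^{1/p}$ is a finite $R$-module. $R^{(e)}$ denotes $R$ viewed as an $R$-algebra via the $e$-th iterate of Frobenius $F^e(r)=r^{p^e}$. For $c\in R$, $\phi_{c,e}:R\to R^{1/q}$ is the $R$-linear map with $\phi_{c,e}(1)=c^{1/q}$, $q=p^e$. Let $E=E_R(k)$ be the injective hull of the residue field and $u$ a generator of its socle. Set $A_e(R)=\{r\in R: r\otimes u=0\text{ in }R^{(e)}\otimes_R E\}$ and $\mathcal P(R)=\{r\in R: r\otimes u=0\text{ in }R^{(e)}\otimes_R E\text{ for all }e\gg0\}=\bigcap_{e\ge1}A_e(R)$. *)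

(* Defs.v *)
From HB Require Import structures.
From mathcomp Require Import all_boot all_order all_algebra all_classical.
From mathcomp Require Import freeg.

Set Implicit Arguments.
Unset Strict Implicit.
Unset Printing Implicit Defensive.

Import GRing.Theory.
Local Open Scope classical_set_scope.
Local Open Scope ring_scope.
Local Open Scope quotient_scope.

Section Submodules.
Variables (R : comNzRingType) (V : lmodType R).

Definition submodule (S : set V) : Prop := submod_closed (mem S).

Lemma submoduleP (S : set V) :
  submodule S <-> S 0 /\ forall a u v, S u -> S v -> S (a *: u + v).
Proof.
split=> -[S0 SD]; split.
- by move: S0; rewrite inE.
- move=> a u v Su Sv.
  by have := SD a u v (mem_set Su) (mem_set Sv); rewrite inE.
- by rewrite inE.
- by move=> a u v; rewrite !inE; apply: SD.
Qed.

Definition span (G : set V) : set V := smallest submodule G.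

Definition fin_gen (S : set V) : Prop := exists s : seq V, S = span [set` s].

Lemma span_submodule (G : set V) : submodule (span G).
Proof.
apply/submoduleP; split=> [S [/submoduleP[]]//|a u v Gu Gv S SG].
by have [/submoduleP[_ SD] _] := SG; apply: SD; [exact: Gu | exact: Gv].
Qed.

Lemma sub_span (G : set V) : G `<=` span G.
Proof. by move=> x Gx S [_]; apply. Qed.

Lemma span_min (G S : set V) : submodule S -> G `<=` S -> span G `<=` S.
Proof. by move=> Ssub GS x; apply. Qed.

End Submodules.

(* Ideals of R are the submodules of R^o; the library's [idealr_closed]
   concerns proper ideals only. *)
Definition noetherian (R : comNzRingType) : Prop :=
  forall I : set R^o, submodule I -> fin_gen I.

Definition reduced_ring (R : comNzRingType) : Prop :=
  forall (x : R) n, x ^+ n = 0 -> x = 0.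

Definition maximal_ideal (R : comNzRingType) (m : {pred R}) : Prop :=
  idealr_closed m /\
  forall J : {pred R}, idealr_closed J -> {subset m <= J} -> J =i m.

Definition local_ring (R : comNzRingType) (m : {pred R}) : Prop :=
  maximal_ideal m /\ forall m' : {pred R}, maximal_ideal m' -> m' =i m.

Definition prime_ideal (R : comNzRingType) (P : set R) : Prop :=
  idealr_closed (mem P) /\ prime_idealr_closed (mem P).

Definition injective_module (R : comNzRingType) (E : lmodType R) : Prop :=
  forall (M N : lmodType R) (f : {linear M -> N}) (g : {linear M -> E}),
    injective f -> exists h : {linear N -> E}, forall x, h (f x) = g x.

Definition essential (R : comNzRingType) (M E : lmodType R)
    (j : {linear M -> E}) : Prop :=
  forall S : set E, submodule S -> S `&` range j `<=` [set 0] ->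
    S `<=` [set 0].

Definition injective_hull (R : comNzRingType) (M E : lmodType R)
    (j : {linear M -> E}) : Prop :=
  [/\ injective_module E, injective j & essential j].

Definition splits (R : comNzRingType) (M N : lmodType R)
    (f : {linear M -> N}) : Prop :=
  exists g : {linear N -> M}, cancel f g.

(* S viewed as an R-algebra via f *)
Definition alg_via (R S : comNzRingType) (f : {rmorphism R -> S}) : Type := S.
Arguments alg_via {R S} f.

Section RestrictionOfScalars.
Variables (R S : comNzRingType) (f : {rmorphism R -> S}).
Local Notation alg_via := (alg_via f).

HB.instance Definition _ := GRing.ComNzRing.on alg_via.

Definition via_scale (a : R) (x : alg_via) : alg_via := f a * x.

Fact via_scaleA a b x : via_scale a (via_scale b x) = via_scale (a * b) x.
Proof. by rewrite /via_scale rmorphM mulrA. Qed.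

Fact via_scale1 : left_id 1 via_scale.
Proof. by move=> x; rewrite /via_scale rmorph1 mul1r. Qed.

Fact via_scaleDr : right_distributive via_scale +%R.
Proof. by move=> a x y; rewrite /via_scale mulrDr. Qed.

Fact via_scaleDl x : {morph via_scale^~ x : a b / a + b}.
Proof. by move=> a b; rewrite /via_scale rmorphD mulrDl. Qed.

HB.instance Definition _ := GRing.Zmodule_isLmodule.Build R alg_via
  via_scaleA via_scale1 via_scaleDr via_scaleDl.

Fact via_scaleAl (a : R) (x y : alg_via) : a *: (x * y) = (a *: x) * y.
Proof. exact: mulrA. Qed.

HB.instance Definition _ := GRing.Lmodule_isLalgebra.Build R alg_via via_scaleAl.

HB.instance Definition _ := GRing.Lalgebra_isComAlgebra.Build R alg_via.

Lemma via_scaleE (a : R) (x : alg_via) : a *: x = (f a : alg_via) * x.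
Proof. by []. Qed.

End RestrictionOfScalars.

Definition frob (R : comNzRingType) (p : nat) (charR : p \in [pchar R])
  (e : nat) : R -> R := fun x => x ^+ (p ^ e)%N.

Section Frobenius.
Variables (R : comNzRingType) (p : nat) (charR : p \in [pchar R]) (e : nat).
Local Notation F := (frob charR e).

Fact frob_is_zmod_morphism : zmod_morphism F.
Proof.
have qR : [pchar R].-nat (p ^ e)%N.
  by rewrite pnatX (eq_pnat _ (pcharf_eq charR)) pnat_id ?(pcharf_prime charR).
by move=> x y; rewrite /frob exprDn_pchar ?exprNn_pchar.
Qed.

Fact frob_is_monoid_morphism : monoid_morphism F.
Proof. by split=> [|x y]; rewrite /frob ?expr1n ?exprMn. Qed.

HB.instance Definition _ :=
  GRing.isZmodMorphism.Build R R F frob_is_zmod_morphism.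
HB.instance Definition _ :=
  GRing.isMonoidMorphism.Build R R F frob_is_monoid_morphism.

End Frobenius.

(* R^(e): the ring R, on which a acts by multiplication by a^(p^e) *)
Definition frob_alg (R : comNzRingType) p (charR : p \in [pchar R]) (e : nat) :=
  alg_via (frob charR e).

Lemma frob_alg_scaleE (R : comNzRingType) p (charR : p \in [pchar R]) e
    (a r : R) :
  a *: (r : frob_alg charR e) = (a ^+ (p ^ e)%N * r : R).
Proof. by []. Qed.

Section Roots.
Variables (R : comNzRingType) (p : nat) (charR : p \in [pchar R]) (e : nat).

(* The ring of q-th roots of elements of R, q = p ^ e. An element is a formal
   symbol [qroot c], standing for c^{1/q}. As (x + y)^{1/q} = x^{1/q} + y^{1/q}
   and (x y)^{1/q} = x^{1/q} y^{1/q}, these symbols are added and multiplied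
   like elements of R; the inclusion of R sends a to (a^q)^{1/q}. For R reduced,
   [qroot_incl_inj], [qroot_exp], [qroot_surj] and [qroot_exp_inj] say that this
   is an extension of R consisting of exactly one q-th root of each element of
   R, and [qroot_ring_unique] that there is only one such extension. *)
Definition qroot_ring of p \in [pchar R] & nat : Type := R.
Local Notation Rq := (qroot_ring charR e).

HB.instance Definition _ := GRing.ComNzRing.on Rq.

Definition qroot : R -> Rq := id.

Fact qroot_is_zmod_morphism : zmod_morphism qroot. Proof. by []. Qed.
Fact qroot_is_monoid_morphism : monoid_morphism qroot. Proof. by []. Qed.

HB.instance Definition _ :=
  GRing.isZmodMorphism.Build R Rq qroot qroot_is_zmod_morphism.
HB.instance Definition _ :=
  GRing.isMonoidMorphism.Build R Rq qroot qroot_is_monoid_morphism.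

Definition qroot_incl : {rmorphism R -> Rq} := qroot \o frob charR e.

Lemma qroot_inclE a : qroot_incl a = qroot (a ^+ (p ^ e)%N). Proof. by []. Qed.

Lemma qroot_exp c : qroot c ^+ (p ^ e)%N = qroot_incl c.
Proof. by rewrite -rmorphXn. Qed.

Lemma qroot_surj (x : Rq) : exists c, x = qroot c.
Proof. by exists x. Qed.

Lemma qroot_inj : injective qroot. Proof. by []. Qed.

Lemma qroot_incl_inj : reduced_ring R -> injective qroot_incl.
Proof.
by move=> redR; apply: raddf_inj => a qa0; apply: (redR a (p ^ e)%N).
Qed.

Lemma qroot_exp_inj :
  reduced_ring R -> injective (fun x : Rq => x ^+ (p ^ e)%N).
Proof. exact: qroot_incl_inj. Qed.

Lemma qroot_ring_unique (S : comNzRingType) (i : {rmorphism R -> S}) :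
    injective i ->
    injective (fun s : S => s ^+ (p ^ e)%N) ->
    (forall s : S, exists c, s ^+ (p ^ e)%N = i c) ->
    (forall c, exists s : S, s ^+ (p ^ e)%N = i c) ->
  exists g : {rmorphism S -> Rq},
    bijective g /\ forall a, g (i a) = qroot_incl a.
Proof.
move=> i_inj q_inj /choice[h hE] /choice[k kE].
have charS : p \in [pchar S] by apply: (rmorph_pchar i).
have hB : zmod_morphism (qroot \o h : S -> Rq).
  move=> x y; congr qroot; apply: i_inj; rewrite rmorphB -!hE.
  exact: (rmorphB (frob charS e)).
have hM : monoid_morphism (qroot \o h : S -> Rq).
  split=> [|x y]; congr qroot; apply: i_inj.
    by rewrite -hE expr1n rmorph1.
  by rewrite rmorphM -!hE exprMn.
pose hBM := GRing.isZmodMorphism.Build S Rq (qroot \o h) hB.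
pose hMM := GRing.isMonoidMorphism.Build S Rq (qroot \o h) hM.
pose g : {rmorphism S -> Rq} := HB.pack (qroot \o h) hBM hMM.
exists g; split=> [|a].
  exists (k : Rq -> S) => [s|c]; first by apply: q_inj; rewrite kE -hE.
  by congr qroot; apply: i_inj; rewrite -hE kE.
by rewrite qroot_inclE; congr qroot; apply: i_inj; rewrite -hE rmorphXn.
Qed.

(* R^{1/q} as an R-algebra *)
Definition qroot_alg := alg_via qroot_incl.

Lemma qroot_alg_scaleE (a c : R) :
  a *: (qroot c : qroot_alg) = qroot (a ^+ (p ^ e)%N * c).
Proof. by []. Qed.

Definition phi_fun (c : R) : R^o -> qroot_alg :=
  fun a => (a : R) *: (qroot c : qroot_alg).

Fact phi_fun_is_linear c : linear (phi_fun c).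
Proof. by move=> a x y; rewrite /phi_fun scalerDl scalerA. Qed.

HB.instance Definition _ c :=
  GRing.isLinear.Build R R^o qroot_alg *:%R (phi_fun c) (phi_fun_is_linear c).

Definition phi (c : R) : {linear R^o -> qroot_alg} := phi_fun c.

Lemma phi1 c : phi c 1 = qroot c. Proof. exact: scale1r. Qed.

End Roots.

Definition F_finite (R : comNzRingType) p (charR : p \in [pchar R]) : Prop :=
  fin_gen [set: qroot_alg charR 1].

Section Tensor.
Variables (R : comNzRingType) (M N : lmodType R).

Local Notation free := {freeg (M * N)%type / R}.
Local Notation gen x y := (<< (x, y) >> : free).

(* M (x)_R N is the quotient of the free R-module on M * N by the submodule
   generated by the elements that express bilinearity. *)
Definition tensor_gens : set free :=
  [set z | [\/ exists x x' y, z = gen (x + x') y - gen x y - gen x' y,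
              exists x y y', z = gen x (y + y') - gen x y - gen x y',
              exists a x y, z = gen (a *: x) y - a *: gen x y
            | exists a x y, z = gen x (a *: y) - a *: gen x y]].

Definition tensor_rels : {pred free} := [pred z | z \in span tensor_gens].

Fact tensor_rels_submod : submod_closed tensor_rels.
Proof.
have /submoduleP[S0 SD] := span_submodule tensor_gens.
by split=> [|a u v]; rewrite !inE //; apply: SD.
Qed.

HB.instance Definition _ :=
  GRing.isSubmodClosed.Build R free tensor_rels
    (GRing.submod_closed_semi tensor_rels_submod).

Definition tensor : Type := {ideal_quot tensor_rels}.

HB.instance Definition _ := GRing.Zmodule.on tensor.
HB.instance Definition _ := Quotient.on tensor.

Definition tensor_pi : free -> tensor := \pi_tensor.

Fact tensor_pi_is_zmod_morphism : zmod_morphism tensor_pi.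
Proof. exact: (@pi_is_zmod_morphism _ _ _ {ideal_quot tensor_rels}). Qed.

HB.instance Definition _ :=
  GRing.isZmodMorphism.Build free tensor tensor_pi tensor_pi_is_zmod_morphism.

Lemma tensor_pi_eq0 z : tensor_pi z = 0 <-> span tensor_gens z.
Proof.
have -> : (tensor_pi z = 0) = (z - 0 \in tensor_rels :> Prop).
  by rewrite Quotient.idealrBE -(raddf0 tensor_pi); apply/propext; split=> /eqP.
by rewrite subr0 !inE.
Qed.

Lemma tensor_piK (t : tensor) : tensor_pi (repr t) = t.
Proof. exact: reprK. Qed.

Lemma tensor_pi_scale a z z' :
  tensor_pi z = tensor_pi z' -> tensor_pi (a *: z) = tensor_pi (a *: z').
Proof.
move=> /eqP; rewrite -subr_eq0 -raddfB => /eqP/tensor_pi_eq0 zz'.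
apply/eqP; rewrite -subr_eq0 -raddfB; apply/eqP/tensor_pi_eq0.
have /submoduleP[S0 SD] := span_submodule tensor_gens.
by rewrite -scalerBr -[X in span _ X]addr0; apply: SD.
Qed.

Definition tensor_scale (a : R) (t : tensor) : tensor :=
  tensor_pi (a *: repr t).

Lemma tensor_scaleE a z : tensor_scale a (tensor_pi z) = tensor_pi (a *: z).
Proof. by apply: tensor_pi_scale; rewrite tensor_piK. Qed.

Fact tensor_scaleA a b t :
  tensor_scale a (tensor_scale b t) = tensor_scale (a * b) t.
Proof. by rewrite -[t]tensor_piK !tensor_scaleE scalerA. Qed.

Fact tensor_scale1 : left_id 1 tensor_scale.
Proof. by move=> t; rewrite -[t]tensor_piK tensor_scaleE scale1r. Qed.

Fact tensor_scaleDr : right_distributive tensor_scale +%R.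
Proof.
move=> a s t; rewrite -[s]tensor_piK -[t]tensor_piK.
by rewrite -raddfD !tensor_scaleE scalerDr raddfD.
Qed.

Fact tensor_scaleDl t : {morph tensor_scale^~ t : a b / a + b}.
Proof.
by move=> a b; rewrite -[t]tensor_piK !tensor_scaleE scalerDl raddfD.
Qed.

HB.instance Definition _ := GRing.Zmodule_isLmodule.Build R tensor
  tensor_scaleA tensor_scale1 tensor_scaleDr tensor_scaleDl.

Fact tensor_pi_is_scalable : scalable tensor_pi.
Proof. by move=> a z; rewrite -tensor_scaleE. Qed.

HB.instance Definition _ :=
  GRing.isScalable.Build R free tensor *:%R tensor_pi tensor_pi_is_scalable.

Definition tens (x : M) (y : N) : tensor := tensor_pi (gen x y).

Lemma tensDl y : {morph tens^~ y : x x' / x + x'}.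
Proof.
move=> x x'; apply/eqP; rewrite -subr_eq0 opprD addrA -!raddfB.
by apply/eqP/tensor_pi_eq0; apply: sub_span; constructor 1; exists x, x', y.
Qed.

Lemma tensDr x : {morph tens x : y y' / y + y'}.
Proof.
move=> y y'; apply/eqP; rewrite -subr_eq0 opprD addrA -!raddfB.
by apply/eqP/tensor_pi_eq0; apply: sub_span; constructor 2; exists x, y, y'.
Qed.

Lemma tensZl a x y : tens (a *: x) y = a *: tens x y.
Proof.
apply/eqP; rewrite -subr_eq0 -linearZ -raddfB.
by apply/eqP/tensor_pi_eq0; apply: sub_span; constructor 3; exists a, x, y.
Qed.

Lemma tensZr a x y : tens x (a *: y) = a *: tens x y.
Proof.
apply/eqP; rewrite -subr_eq0 -linearZ -raddfB.
by apply/eqP/tensor_pi_eq0; apply: sub_span; constructor 4; exists a, x, y.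
Qed.

End Tensor.

Section FreeLift.
Variables (R : comNzRingType) (K : choiceType) (W : lmodType R) (f : K -> W).
Local Notation g := (fglift f).

Lemma freegU_scale (a k : R) (x : K) :
  a *: << k *g x >> = << a * k *g x >> :> {freeg K / R}.
Proof. by apply/eqP/freeg_eqP=> z; rewrite coeffZ !coeffU mulrA. Qed.

HB.instance Definition _ :=
  GRing.isZmodMorphism.Build {freeg K / R} W g (lift_is_additive f).

Fact fglift_is_scalable : scalable g.
Proof.
move=> a D; have gZ x k : g (a *: << k *g x >>) = a *: g << k *g x >>.
  by rewrite freegU_scale !liftU scalerA.
rewrite -(freeg_sumE D); elim: (dom D) => [|x s IHs].
  by rewrite !big_nil !(raddf0, scaler0).
by rewrite !big_cons scalerDr !raddfD /= -gZ -IHs.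
Qed.

HB.instance Definition _ :=
  GRing.isScalable.Build R {freeg K / R} W *:%R g fglift_is_scalable.

End FreeLift.

Lemma tensor_universal (R : comNzRingType) (M N W : lmodType R)
    (b : M -> N -> W) :
    (forall y, linear (b^~ y)) -> (forall x, linear (b x)) ->
  exists2 h : {linear tensor M N -> W}, (forall x y, h (tens x y) = b x y) &
    forall h' : {linear tensor M N -> W},
      (forall x y, h' (tens x y) = b x y) -> h' =1 h.
Proof.
move=> bl br.
have bDl x x' y : b (x + x') y = b x y + b x' y.
  by have := bl y 1 x x'; rewrite !scale1r.
have bDr x y y' : b x (y + y') = b x y + b x y'.
  by have := br x 1 y y'; rewrite !scale1r.
have b0l y : b 0 y = 0 by apply: (addrI (b 0 y)); rewrite -bDl !addr0.
have b0r x : b x 0 = 0 by apply: (addrI (b x 0)); rewrite -bDr !addr0.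
have bZl a x y : b (a *: x) y = a *: b x y.
  by have := bl y a x 0; rewrite b0l !addr0.
have bZr a x y : b x (a *: y) = a *: b x y.
  by have := br x a y 0; rewrite b0r !addr0.
pose f (xy : M * N) := b xy.1 xy.2.
have fE1 x y : fglift f << (x, y) >> = b x y by rewrite liftU scale1r.
have fE z z' : tensor_pi z = tensor_pi z' -> fglift f z = fglift f z'.
  move=> /eqP; rewrite -subr_eq0 -raddfB => /eqP/tensor_pi_eq0 zz'.
  apply/eqP; rewrite -subr_eq0 -raddfB; apply/eqP.
  pose S := [set z | fglift f z = 0].
  apply: (@span_min _ _ _ S) zz'.
    apply/submoduleP; split=> [|a u v]; rewrite /S /= ?raddf0 //.
    by move=> u0 v0; rewrite linearP /= u0 v0 scaler0 addr0.
  move=> t [] [a [x [y]]].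
  - by move=> ->; rewrite /S /= !raddfB /= !liftU !scale1r /f /= bDl addrAC addrK subrr.
  - by move=> ->; rewrite /S /= !raddfB /= !liftU !scale1r /f /= bDr addrAC addrK subrr.
  - by move=> ->; rewrite /S /mkset raddfB [X in _ - X](fglift_is_scalable f a)
      [X in X - _]fE1 [X in _ - X](congr1 _ (fE1 x y)) bZl subrr.
  - by move=> ->; rewrite /S /mkset raddfB [X in _ - X](fglift_is_scalable f a)
      [X in X - _]fE1 [X in _ - X](congr1 _ (fE1 x y)) bZr subrr.
pose h (t : tensor M N) := fglift f (repr t).
have hE z : h (tensor_pi z) = fglift f z by apply: fE; rewrite tensor_piK.
have hlin : linear h.
  move=> a s t; rewrite -[s]tensor_piK -[t]tensor_piK.
  by rewrite -linearP !hE linearP.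
pose hL := GRing.isLinear.Build R (tensor M N) W *:%R h hlin.
pose H : {linear tensor M N -> W} := HB.pack h hL.
exists H => [x y|h' h'E t]; first by rewrite /H /= /tens hE liftU scale1r.
rewrite /H /= -[t]tensor_piK hE -(freeg_sumE (repr t)).
elim: (dom _) => [|[x y] s IHs]; first by rewrite !big_nil !raddf0.
rewrite !big_cons !raddfD /= IHs; congr (_ + _).
rewrite -[coeff _ _]mulr1 -freegU_scale !linearZ /= liftU scale1r.
by rewrite -[tensor_pi _]/(tens x y) h'E.
Qed.

(* R / m as an R-module *)
Definition residue_field (R : comNzRingType) (m : idealr R) : lmodType R :=
  alg_via (\pi_{ideal_quot m} : {rmorphism R -> {ideal_quot m}}).

(* Soc(E) = (0 :_E m), as usual over a local ring (R, m). *)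
Definition socle (R : comNzRingType) (m : {pred R}) (E : lmodType R) : set E :=
  [set x | forall a, a \in m -> a *: x = 0].
Arguments socle {R} m E.

Definition socle_generator (R : comNzRingType) (m : {pred R}) (E : lmodType R)
    (u : E) : Prop :=
  socle m E = span [set u].

Section SplittingSets.
Variables (R : comNzRingType) (p : nat) (charR : p \in [pchar R]).
Variables (E : lmodType R) (u : E).

Definition A_ (e : nat) : set R :=
  [set r | tens (r : frob_alg charR e) u = 0].

Definition P_ : set R :=
  [set r | exists e0, forall e, (e0 <= e)%N -> A_ e r].

End SplittingSets.

(* Main.v *)
(* Write M for R^(e), which is R^{1/q} as an R-module; it is finite over R and
   hence finitely presented. Because E is injective, M (x) E embeds into
   Hom(Hom(M, R), E) through x (x) v |-> (g |-> g x *: v), without completing R.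
   Hence c (x) u = 0 iff g c *: u = 0 for all g : M -> R, i.e. iff every g c
   lies in m, which, R being local, says that no g has g c = 1.
   If moreover g splits a at level e and g' splits b at level e', then their
   composite sends b^q a, a multiple of a b, to 1, so a b splits at level
   e + e'; thus if a and b are outside P(R), then so is a b. *)
From HB Require Import structures.
Require Import Defs.
From mathcomp Require Import all_boot all_order all_algebra all_classical.

Set Implicit Arguments.
Unset Strict Implicit.
Unset Printing Implicit Defensive.

Import GRing.Theory.
Local Open Scope classical_set_scope.
Local Open Scope ring_scope.

Local Notation span := Defs.span.

(** * Spans of finite sequences and finite generation over a Noetherian ring *)

Section Span.
Variables (R : comNzRingType) (V : lmodType R).
Implicit Types (S : set V) (s : seq V).

Lemma submoduleD S x y : submodule S -> S x -> S y -> S (x + y).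
Proof. by move=> /submoduleP[_ SD] Sx Sy; rewrite -[x]scale1r; apply: SD. Qed.

Lemma submoduleZ S a x : submodule S -> S x -> S (a *: x).
Proof. by move=> /submoduleP[S0 SD] Sx; rewrite -[_ *: _]addr0; apply: SD. Qed.

Lemma submodule_sum S (I : Type) (r : seq I) (F : I -> V) :
  submodule S -> (forall i, S (F i)) -> S (\sum_(i <- r) F i).
Proof.
move=> Ssub SF; apply: (big_ind S) => //; first by have /submoduleP[] := Ssub.
by move=> x y; apply: submoduleD.
Qed.

Lemma span_seqP s x :
  span [set` s] x <->
  exists a : 'I_(size s) -> R, x = \sum_(i < size s) a i *: s`_i.
Proof.
split=> [|[a ->]]; last first.
  apply: submodule_sum (span_submodule _) _ => i.
  apply: submoduleZ (span_submodule _) _.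
  by apply: Defs.sub_span; rewrite /= mem_nth.
pose S := [set x | exists a : 'I_(size s) -> R,
                     x = \sum_(i < size s) a i *: s`_i].
apply: (@span_min _ _ _ S) => [|{}x /= xs].
  apply/submoduleP; split=> [|k _ _ [a ->] [b ->]].
    by exists (fun=> 0); rewrite big1 // => i _; rewrite scale0r.
  exists (fun i => k * a i + b i); rewrite scaler_sumr -big_split /=.
  by apply: eq_bigr => i _; rewrite scalerDl scalerA.
have xi : (index x s < size s)%N by rewrite index_mem.
exists (fun i => (i == Ordinal xi)%:R).
rewrite (bigD1 (Ordinal xi)) //= eqxx scale1r nth_index // big1 ?addr0 //.
by move=> i /negPf->; rewrite scale0r.
Qed.

Lemma span_consP x s y :
  span [set` x :: s] y -> exists a, span [set` s] (y - a *: x).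
Proof.
move=> /span_seqP[a ->]; exists (a ord0).
rewrite big_ord_recl /= addrAC subrr add0r; apply/span_seqP.
by exists (a \o lift ord0).
Qed.

End Span.

(** Induction on the generators. The part of [S] inside [span s] is generated by some [t], and the
    coefficients of [x] occurring in [S] modulo [span s] form an ideal [I]. Then [t], together with
    lifts to [S] of generators of [I], generates [S]. *)
Lemma noetherian_module (R : comNzRingType) (V : lmodType R) (s : seq V)
    (S : set V) :
  noetherian R -> submodule S -> S `<=` span [set` s] -> fin_gen S.
Proof.
move=> R_noeth; elim: s S => [|x s IHs] S Ssub Ss.
  exists [::]; apply/seteqP; split=> //.
  by apply: span_min => // y; rewrite /= in_nil.
have [S0 SD] := (submoduleP S).1 Ssub.
have [T0 TD] := (submoduleP _).1 (span_submodule [set` s]).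
have [t tE] : fin_gen (S `&` span [set` s]).
  apply: IHs => [|y []//]; apply/submoduleP; split=> // a u v [Su Tu] [Sv Tv].
  by split; [apply: SD | apply: TD].
pose I : set R^o := [set a | exists2 y, S y & span [set` s] (y - a *: x)].
have [c cE] : fin_gen I.
  apply: R_noeth; apply/submoduleP; split.
    by exists 0; rewrite ?scale0r ?subr0.
  move=> k a b [u Su ua] [v Sv vb]; exists (k *: u + v); first exact: SD.
  suff -> : k *: u + v - (k *: a + b) *: x = k *: (u - a *: x) + (v - b *: x).
    exact: TD.
  by rewrite scalerDl scalerBr scalerA opprD addrACA.
(* [w] lifts the generators [c] of [I] to [S]. Outside [c] its value is the default 0, about which
   nothing is claimed. *)
have /choice[w wP] a : exists y, a \in c -> S y /\ span [set` s] (y - a *: x).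
  have [ac|nac] := boolP (a \in c); last by exists 0.
  have : I a by rewrite cE; apply: Defs.sub_span.
  by case=> y Sy ya; exists y.
exists (t ++ map w c); apply/seteqP; split=> [y Sy|]; last first.
  apply: span_min => // y /=; rewrite mem_cat => /orP[yt|].
    have : span [set` t] y by apply: Defs.sub_span.
    by rewrite -tE => -[].
  by case/mapP=> a ac ->; have [] := wP a ac.
have subT : span [set` t] `<=` span [set` t ++ map w c].
  apply: span_min (span_submodule _) _ => z zt; apply: Defs.sub_span.
  by rewrite /= mem_cat zt.
have [a ya] := span_consP (Ss _ Sy).
have : I a by exists y.
rewrite cE => /span_seqP[b aE].
(* [z] has the same coefficient [a] of [x] as [y], so [y - z] falls into [span s], where [t] takes
   over. *)
pose z := \sum_(i < size c) b i *: w c`_i.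
have Sz : S z.
  apply: submodule_sum => // i; apply: submoduleZ => //.
  by have [] := wP c`_i (mem_nth _ (ltn_ord i)).
have zT : span [set` t ++ map w c] z.
  apply: submodule_sum (span_submodule _) _ => i.
  apply: submoduleZ (span_submodule _) _; apply: Defs.sub_span.
  by rewrite /= mem_cat map_f ?orbT ?mem_nth.
rewrite -[y](subrK z); apply: submoduleD (span_submodule _) _ zT.
apply: subT; rewrite -tE; split.
  by rewrite -scaleN1r addrC; apply: SD.
have -> : y - z = -1 *: (z - a *: x) + (y - a *: x).
  by rewrite scaleN1r opprB [RHS]addrC addrA subrK.
apply: TD ya.
rewrite aE scaler_suml -sumrB; apply: submodule_sum (span_submodule _) _ => i.
have [_ wT] := wP c`_i (mem_nth _ (ltn_ord i)).
suff -> : b i *: w c`_i - (b i *: c`_i) *: x = b i *: (w c`_i - c`_i *: x).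
  exact: submoduleZ (span_submodule _) wT.
by rewrite scalerBr scalerA.
Qed.

(** * Images of linear maps and extension into injective modules *)

Section Image.
Variables (R : comNzRingType) (V W : lmodType R) (f : {linear V -> W}).

(** [injective_module] quantifies over modules given as types, so the image must become a type. A
    boolean predicate lets its subtype inherit the module structure of [W]. *)
Definition image_pred : {pred W} := [pred w | `[< range f w >]].

Fact image_pred_submod : submod_closed image_pred.
Proof.
split=> [|a _ _ /asboolP[x _ <-] /asboolP[y _ <-]]; apply/asboolP.
  by exists 0; rewrite ?raddf0.
by exists (a *: x + y); rewrite ?linearP.
Qed.

HB.instance Definition _ := GRing.isSubmodClosed.Build R W image_pred
  (GRing.submod_closed_semi image_pred_submod).

Definition image_module := {w : W | w \in image_pred}.
HB.instance Definition _ := SubChoice.on image_module.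
HB.instance Definition _ := [SubChoice_isSubLmodule of image_module by <:].

End Image.

(** The map [l] descends to the image of [f], a submodule of [W], and injectivity of [E] extends it
    from there to [W]. *)
Lemma injective_factor (R : comNzRingType) (V W E : lmodType R)
    (f : {linear V -> W}) (l : {linear V -> E}) :
    injective_module E -> (forall v, f v = 0 -> l v = 0) ->
  exists h : {linear W -> E}, forall v, h (f v) = l v.
Proof.
move=> E_inj fl; pose M := image_module f.
have fl_eq x y : f x = f y -> l x = l y.
  move=> fxy; apply/eqP; rewrite -subr_eq0 -raddfB; apply/eqP/fl.
  by rewrite linearB /= fxy subrr.
(* The section [s] need not be linear, but [l \o s] is, because [l] is constant on the fibres of
   [f]. *)
have /choice[s sE] : forall w : M, exists x, f x = val w.
  by move=> [w /= /asboolP[x _ <-]]; exists x.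
have gE w x : f x = val w -> l (s w) = l x.
  by move=> xw; apply: fl_eq; rewrite sE.
have g_lin : linear (l \o s : M -> E).
  move=> a x y /=; rewrite -linearP; apply: gE.
  by rewrite linearP !sE.
pose gL := GRing.isLinear.Build R M E *:%R (l \o s) g_lin.
pose g : {linear M -> E} := HB.pack (l \o s) gL.
have [h hE] := E_inj M W (val : {linear M -> W}) g val_inj.
exists h => v.
have fv : f v \in image_pred f by apply/asboolP; exists v.
by rewrite -[f v]/(val (Sub (f v) fv : M)) hE /= (@gE _ v).
Qed.

Lemma linear_fun (R : comNzRingType) (V W : lmodType R) (f : V -> W) :
  linear f -> exists g : {linear V -> W}, g =1 f.
Proof.
move=> f_lin; pose fL := GRing.isLinear.Build R V W *:%R f f_lin.
by exists (HB.pack f fL : {linear V -> W}).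
Qed.

(** * Vanishing of a pure tensor, tested by linear forms *)

Lemma tens_suml (R : comNzRingType) (M N : lmodType R) (I : finType)
    (F : I -> M) (y : N) :
  tens (\sum_i F i) y = \sum_i tens (F i) y.
Proof.
have T_lin : linear (fun x : M => tens x y).
  by move=> k x x'; rewrite tensDl tensZl.
have [T TE] := linear_fun T_lin.
by rewrite -[LHS]TE linear_sum; apply: eq_bigr => i _; apply: TE.
Qed.

Lemma tens_sumr (R : comNzRingType) (M N : lmodType R) (I : finType)
    (x : M) (F : I -> N) :
  tens x (\sum_i F i) = \sum_i tens x (F i).
Proof.
have T_lin : linear (fun y : N => tens x y).
  by move=> k y y'; rewrite tensDr tensZr.
have [T TE] := linear_fun T_lin.
by rewrite -[LHS]TE linear_sum; apply: eq_bigr => i _; apply: TE.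
Qed.

(* Let A be the matrix of the relations among generators s_i of M and
   c = sum_i b_i s_i. The hypothesis says that v |-> (v . b) *: u kills
   ker (v |-> v A) = Hom(M, R), so it factors through v |-> v A; the factor
   provides e_k with b_i *: u = sum_k A_ik *: e_k, and the relations kill the
   tensor. *)
Lemma tens_eq0 (R : comNzRingType) (M E : lmodType R) (c : M) (u : E) :
    noetherian R -> fin_gen [set: M] -> injective_module E ->
    (forall g : {linear M -> R^o}, (g c : R) *: u = 0) ->
  tens c u = 0.
Proof.
move=> R_noeth [s sE] E_inj c0.
have coord y : exists a : 'rV[R]_(size s), y = \sum_i a 0 i *: s`_i.
  have : [set: M] y by [].
  rewrite sE => /span_seqP[a ->]; exists (\row_i a i).
  by apply: eq_bigr => i _; rewrite mxE.
pose rel := [set a : 'rV[R]_(size s) | \sum_i a 0 i *: s`_i = 0].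
have rel_lin (k : R) (a b : 'rV[R]_(size s)) :
    \sum_i (k *: a + b) 0 i *: s`_i
      = k *: (\sum_i a 0 i *: s`_i) + \sum_i b 0 i *: s`_i.
  rewrite scaler_sumr -big_split; apply: eq_bigr => i _.
  by rewrite !mxE scalerDl scalerA.
have [t tE] : fin_gen rel.
  apply: (noetherian_module (s := [seq delta_mx 0 i | i : 'I_(size s)])) => //.
    apply/submoduleP; split=> [|k a b]; rewrite /rel /=.
      by rewrite big1 // => i _; rewrite mxE scale0r.
    by move=> a0 b0; rewrite rel_lin a0 b0 scaler0 addr0.
  move=> a _; rewrite (row_sum_delta a).
  apply: submodule_sum (span_submodule _) _ => i.
  apply: submoduleZ (span_submodule _) _; apply: Defs.sub_span.
  exact: fintype.image_f.
have relt (k : 'I_(size t)) : rel t`_k.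
  by rewrite tE; apply: Defs.sub_span; rewrite /= mem_nth.
pose A := \matrix_(i < size s, k < size t) t`_k 0 i.
have [b cE] := coord c.
have l_lin : linear (fun v : 'rV[R]_(size s) => (\sum_i v 0 i * b 0 i) *: u).
  move=> k v w; rewrite scalerA -scalerDl mulr_sumr -big_split; congr (_ *: u).
  by apply: eq_bigr => i _; rewrite !mxE mulrDl mulrA.
have [l lE] := linear_fun l_lin.
have [h hE] : exists h : {linear 'rV[R]_(size t) -> E},
    forall v : 'rV_(size s), h (mulmxr A v) = l v.
  apply: injective_factor => // v /= vA0.
  (* The columns of [A] generate all relations, so [v *m A = 0] makes [v] vanish on every
     relation. *)
  have v0 a : rel a -> \sum_i v 0 i * a 0 i = 0.
    pose S := [set a : 'rV[R]_(size s) | \sum_i v 0 i * a 0 i = 0].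
    rewrite tE; apply: (@span_min _ _ _ S).
      apply/submoduleP; split=> [|k x y]; rewrite /S /=.
        by rewrite big1 // => i _; rewrite mxE mulr0.
      move=> x0 y0; have -> : \sum_i v 0 i * (k *: x + y) 0 i =
          k * (\sum_i v 0 i * x 0 i) + \sum_i v 0 i * y 0 i.
        rewrite mulr_sumr -big_split; apply: eq_bigr => i _.
        by rewrite !mxE mulrDr mulrCA.
      by rewrite x0 y0 mulr0 addr0.
    move=> _ /(nthP 0)[k kt <-]; rewrite /S /=.
    transitivity ((v *m A) 0 (Ordinal kt)); last by rewrite vA0 mxE.
    by rewrite mxE; apply: eq_bigr => i _; rewrite mxE.
  (* The chosen coordinates [w y] need not be linear in [y]. Two coordinate vectors of [y] differ by
     a relation, which [v] kills, so pairing with [v] is a well-defined linear form on [M]. *)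
  have /choice[w wE] := coord.
  have wP y (a : 'rV[R]_(size s)) : y = \sum_i a 0 i *: s`_i ->
      \sum_i v 0 i * w y 0 i = \sum_i v 0 i * a 0 i.
    move=> yE; apply/eqP; rewrite -subr_eq0 -sumrB; apply/eqP.
    rewrite -[RHS](v0 (- 1 *: a + w y)).
      by apply: eq_bigr => i _; rewrite !mxE mulN1r mulrDr mulrN addrC.
    by rewrite /rel /= rel_lin -yE -wE scaleN1r addNr.
  have g_lin : linear (fun y : M => \sum_i v 0 i * w y 0 i : R^o).
    move=> k x y; rewrite (wP _ (k *: w x + w y)) ?rel_lin -?wE //.
    rewrite scaler_sumr -big_split; apply: eq_bigr => i _.
    by rewrite !mxE mulrDr mulrCA.
  have [g gE] := linear_fun g_lin.
  by rewrite lE -(wP _ _ cE) -gE c0.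
pose e k := h (delta_mx 0 k).
have bE i : b 0 i *: u = \sum_k A i k *: e k.
  have <- : l (delta_mx 0 i) = b 0 i *: u.
    rewrite lE (bigD1 i) //= !mxE !eqxx mul1r big1 ?addr0 // => j /negPf ji.
    by rewrite mxE ji andbF mul0r.
  rewrite -hE /= -rowE (row_sum_delta (row i A)) linear_sum.
  by apply: eq_bigr => k _; rewrite linearZ mxE.
have step i : tens (b 0 i *: s`_i) u = \sum_k tens (A i k *: s`_i) (e k).
  rewrite tensZl -tensZr bE tens_sumr; apply: eq_bigr => k _.
  by rewrite tensZr tensZl.
rewrite cE tens_suml (eq_bigr _ (fun i _ => step i)) exchange_big.
rewrite big1 //= => k _.
rewrite -tens_suml; have -> : \sum_i A i k *: s`_i = 0.
  by rewrite -[RHS](relt k); apply: eq_bigr => i _; rewrite mxE.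
by rewrite -(scale0r 0) tensZl scale0r.
Qed.

(** * Units of a local ring *)

(** Were [a] not invertible, Zorn's lemma would put it in some maximal ideal, which by locality is
    [m]. *)
Lemma local_ring_inv (R : comNzRingType) (m : {pred R}) (a : R) :
  local_ring m -> a \notin m -> exists b, b * a = 1.
Proof.
move=> [_ m_unique] a_notin; apply: contrapT => a_noninv.
pose P (X : set R) := X = set0 \/ X a /\ idealr_closed (mem X).
have [F FP Ftot|A [PA Amax]] := @Zorn_bigcup R P.
  have [[X0 FX0 X0a]|F0] := pselect (exists2 X, F X & X a); last first.
    left; apply: contrapT => /eqP/set0P[x [X FX Xx]].
    by case: (FP X FX) => [X0|[Xa _]]; [rewrite X0 in Xx | case: F0; exists X].
  have idl X x : F X -> X x -> idealr_closed (mem X).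
    by move=> /FP[-> //|[]].
  right; split; first by exists X0.
  split.
  - have [X00 _ _] := idl _ _ FX0 X0a; rewrite inE in X00.
    by rewrite inE; exists X0.
  - rewrite notin_setE => -[X FX X1]; have [_] := idl _ _ FX X1.
    by rewrite notin_setE.
  move=> k x y; rewrite !inE => -[X FX Xx] [Y FY Yy].
  have [XY|YX] := Ftot X Y FX FY.
    have [_ _ YD] := idl _ _ FY Yy; exists Y => //.
    by move: (YD k x y); rewrite !inE; apply=> //; apply: XY.
  have [_ _ XD] := idl _ _ FX Xx; exists X => //.
  by move: (XD k x y); rewrite !inE; apply=> //; apply: YX.
pose aR := [set x | exists b, x = b * a].
have PaR : P aR.
  right; split; first by exists 1; rewrite mul1r.
  split.
  - by rewrite inE; exists 0; rewrite mul0r.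
  - by rewrite notin_setE => -[b b1]; apply: a_noninv; exists b.
  by move=> k x y; rewrite !inE => -[b ->] [c ->]; exists (k * b + c);
    rewrite mulrDl mulrA.
have [A0|[Aa Aid]] := PA.
  apply: (Amax aR) => //; rewrite A0; split=> [//|/(_ a)]; apply.
  by exists 1; rewrite mul1r.
have Amaxid : maximal_ideal (mem A).
  split=> // J Jid AJ x; apply/idP/idP => [Jx|/AJ//].
  have PJ : P [set` J].
    right; split; first by apply: AJ; rewrite inE.
    case: Jid => J0 J1 JD; split; first by rewrite inE.
      by rewrite notin_setE; apply/negP.
    by move=> k y z; rewrite !inE; apply: JD.
  apply: contrapT => Ax; apply: (Amax [set` J] _ PJ); split=> [y Ay|JA].
    by apply: AJ; rewrite inE.
  by apply: Ax; rewrite inE; apply: JA.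
by move/negP: a_notin; apply; rewrite -(m_unique _ Amaxid) inE.
Qed.

(** * Frobenius modules and the splitting of [phi] *)

Section FrobeniusModules.
Variables (R : comNzRingType) (p : nat) (charR : p \in [pchar R]).

(** Put q = p^e. If the [x i] generate R^(e) and the s_k generate R^{1/p}, expanding the
    coefficients [a i] in the s_k shows that the products of s_k^q and [x i] generate R^(e+1). *)
Lemma F_finite_frob_alg e :
  F_finite charR -> fin_gen [set: frob_alg charR e].
Proof.
move=> [s sE].
have s_gen r : exists a : 'I_(size s) -> R, r = \sum_i a i ^+ p * s`_i.
  have : [set: qroot_alg charR 1] r by [].
  by rewrite sE => /span_seqP[a ->]; exists a; apply: eq_bigr.
suff [I [x xP]] : exists (I : finType) (x : I -> R), forall r,
    exists a : I -> R, r = \sum_i a i ^+ (p ^ e)%N * x i.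
  exists (codom x : seq (frob_alg charR e)); apply/seteqP; split=> // r _.
  have [a ->] := xP r; apply: submodule_sum (span_submodule _) _ => i.
  apply: (@submoduleZ _ (frob_alg charR e)) (span_submodule _) _.
  by apply: Defs.sub_span; apply: codom_f.
elim: e => [|e [I [x xP]]].
  exists unit, (fun=> 1) => r; exists (fun=> r).
  by rewrite big_const card_unit /= mulr1 addr0.
exists (I * 'I_(size s))%type, (fun ij : I * 'I_(size s) =>
  (s`_(ij.2) : R) ^+ (p ^ e)%N * x ij.1) => r.
have [a ->] := xP r.
have /choice[b bE] i := s_gen (a i).
exists (fun ij : I * 'I_(size s) => b ij.1 ij.2); rewrite -(pair_bigA _
  (fun i k => b i k ^+ (p ^ e.+1)%N * ((s`_k : R) ^+ (p ^ e)%N * x i))) /=.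
apply: eq_bigr => i _; rewrite bE -[X in X * _]/(frob charR e _) rmorph_sum.
rewrite mulr_suml; apply: eq_bigr => k _.
by rewrite rmorphM /= /frob -exprM -expnS mulrA.
Qed.

(* R-linear maps R^(e) -> R, equivalently R^{1/q} -> R, as functions on R. *)
Definition root_linear (e : nat) (g : R -> R) : Prop :=
  forall a x y, g (a ^+ (p ^ e)%N * x + y) = a * g x + g y.

Lemma root_linearZ e g a x :
  root_linear e g -> g (a ^+ (p ^ e)%N * x) = a * g x.
Proof.
move=> g_lin; have g0 : g 0 = 0.
  by apply: (addrI (g 0)); have := g_lin 1 0 0; rewrite mulr0 !addr0 mul1r.
by have := g_lin a x 0; rewrite g0 !addr0.
Qed.

(** As 1 generates [R^o], a linear [g] is a retraction of [phi] as soon as it sends the image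
    [qroot c] of 1 back to 1. *)
Lemma splits_phiP e c :
  splits (phi charR e c) <-> exists2 g, root_linear e g & g c = 1.
Proof.
split=> [[g gK]|[g g_lin gc1]].
  exists g; first by move=> a x y; apply: (linearP g).
  by have := gK 1; rewrite phi1.
have g_linear : linear (g : qroot_alg charR e -> R^o) by exact: g_lin.
have [g' gE] := linear_fun g_linear; exists g' => a.
by rewrite gE [LHS](root_linearZ _ _ g_lin) gc1 mulr1.
Qed.

(** A p^(e+e')-th power is the p^e-th power of a p^e'-th power: [g] extracts the outer root and [g']
    the inner one. *)
Lemma root_linear_comp e e' g g' : root_linear e g -> root_linear e' g' ->
  root_linear (e + e') (g' \o g).
Proof.
move=> g_lin g'_lin a x y /=.
by rewrite addnC expnD exprM g_lin g'_lin.
Qed.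

Lemma splits_phiM e e' a b :
    splits (phi charR e a) -> splits (phi charR e' b) ->
  splits (phi charR (e + e') (a * b)).
Proof.
move=> /splits_phiP[g g_lin ga] /splits_phiP[g' g'_lin gb]; apply/splits_phiP.
have pe : (0 < p ^ e)%N by rewrite expn_gt0 prime_gt0 // (pcharf_prime charR).
(* With q = p^e, the factor b^(q-1) turns a b into b^q a, which [g] sends to b and [g'] then sends
   to 1. *)
exists (fun x => g' (g (b ^+ (p ^ e).-1 * x))) => [k x y|].
  rewrite mulrDr mulrCA.
  exact: (root_linear_comp g_lin g'_lin).
have -> : b ^+ (p ^ e).-1 * (a * b) = b ^+ (p ^ e) * a.
  by rewrite mulrCA mulrC -exprSr prednK.
by rewrite (root_linearZ _ _ g_lin) ga mulr1.
Qed.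

Lemma splits_phi_mulr e a b :
  splits (phi charR e (a * b)) -> splits (phi charR e b).
Proof.
move=> /splits_phiP[g g_lin gab]; apply/splits_phiP.
by exists (fun x => g (a * x)) => // k x y; rewrite mulrDr mulrCA g_lin.
Qed.

Lemma A_D (E : lmodType R) (u : E) e x y :
  A_ charR u e x -> A_ charR u e y -> A_ charR u e (x + y).
Proof.
rewrite /A_ /= => x0 y0.
by rewrite (tensDl u (x : frob_alg charR e) y) x0 y0 addr0.
Qed.

Lemma A_nonsplit (m : idealr R) (E : lmodType R) (u : E) e :
    noetherian R -> local_ring m -> F_finite charR -> injective_module E ->
    u != 0 -> socle m E u ->
  A_ charR u e = [set c | ~ splits (phi charR e c)].
Proof.
move=> R_noeth R_local R_Ffin E_inj u0 u_soc.
apply/seteqP; split=> c /= => [c0 /splits_phiP[g g_lin gc]|c_nonsplit].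
  (* A splitting [g] induces a map from the tensor product to [E] sending c (x) u to [g c *: u = u],
     which is nonzero. *)
  have bl (y : E) : linear (fun x : frob_alg charR e => g x *: y).
    by move=> a x x'; rewrite scalerA -scalerDl; congr (_ *: y); apply: g_lin.
  have br (x : frob_alg charR e) : linear (fun y : E => g x *: y).
    by move=> a y y'; rewrite scalerDr !scalerA mulrC.
  have [h hE _] := tensor_universal bl br.
  move/eqP: u0; apply; rewrite -[u]scale1r -gc -hE.
  by rewrite [tens _ _]c0 linear0.
apply: tens_eq0 => //; first exact: F_finite_frob_alg.
(* If [g c] lies in [m], it kills [u]. Otherwise it has an inverse [b], and rescaling [g] by [b]
   would split [c]. *)
move=> g; have [gm|gNm] := boolP ((g c : R) \in m); first exact: u_soc.
have [b bg] := local_ring_inv R_local gNm.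
case: c_nonsplit; apply/splits_phiP; exists (fun x => b * g x) => // a x y.
have -> : g (a ^+ (p ^ e)%N * x + y) = a *: g x + g y by apply: (linearP g).
by rewrite mulrDr mulrCA.
Qed.

End FrobeniusModules.

(** * The socle generator and the primality of P(R) *)

(** The image under [j] of the residue class of 1 is a nonzero element of the socle, so the socle
    cannot be spanned by 0. *)
Lemma socle_generator_neq0 (R : comNzRingType) (m : idealr R) (E : lmodType R)
    (j : {linear residue_field m -> E}) (u : E) :
  injective j -> socle_generator m u -> u != 0.
Proof.
move=> j_inj u_gen; apply/eqP => u0.
have : socle m E (j 1).
  move=> a am; rewrite -linearZ.
  suff -> : a *: (1 : residue_field m) = 0 by rewrite linear0.
  rewrite via_scaleE mulr1; apply/eqP.
  by rewrite -(rmorph0 (\pi_{ideal_quot m})%qT) -Quotient.idealrBE subr0.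
rewrite u_gen u0 => /(_ [set 0]) j1.
have : j 1 = 0.
  apply: j1; split=> //; apply/submoduleP; split=> // a _ _ -> ->.
  by rewrite scaler0 addr0.
by rewrite -(linear0 j) => /j_inj/eqP; rewrite oner_eq0.
Qed.

Theorem theorem3p3 (R : comNzRingType) (p : nat) (charR : p \in [pchar R])
  (m : idealr R) (R_noetherian : noetherian R) (R_local : local_ring m)
  (R_reduced : reduced_ring R) (R_Ffinite : F_finite charR)
  (E : lmodType R) (j : {linear residue_field m -> E})
  (E_hull : injective_hull j) (u : E) (u_gen : socle_generator m u) :
  (forall e : nat, A_ charR u e = [set c | ~ splits (phi charR e c)]) /\
  (prime_ideal (P_ charR u) \/ P_ charR u = setT).
Proof.
have [E_inj j_inj _] := E_hull.
have u_soc : socle m E u by rewrite u_gen; apply: Defs.sub_span.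
have u0 := socle_generator_neq0 j_inj u_gen.
have AE e : A_ charR u e = [set c | ~ splits (phi charR e c)].
  exact: (A_nonsplit e R_noetherian R_local R_Ffinite).
split=> //.
(* Sums are handled through the tensor description of [A_], multiples through the splitting
   description. *)
have PD x y : P_ charR u x -> P_ charR u y -> P_ charR u (x + y).
  move=> [e1 xA] [e2 yA]; exists (maxn e1 e2) => e; rewrite geq_max.
  by move=> /andP[/xA ? /yA]; apply: A_D.
have PM a x : P_ charR u x -> P_ charR u (a * x).
  move=> [e0 xA]; exists e0 => e /xA; rewrite AE /= => x_nonsplit.
  by move=> /splits_phi_mulr.
(* [idealr_closed] includes properness, hence the separate case of the unit ideal. *)
have [P1|P1] := pselect (P_ charR u 1); [right|left].
  by apply/seteqP; split=> // x _; rewrite -[x]mulr1; apply: PM.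
have P0 : P_ charR u 0.
  exists 0%N => e _.
  by rewrite /A_ /= -(scale0r (0 : frob_alg charR e)) tensZl scale0r.
split=> [|x y].
  split; rewrite ?notin_setE ?inE // => a x y.
  by rewrite !inE => Px Py; apply: PD => //; apply: PM.
have splits_of_notP z : ~ P_ charR u z ->
    forall e0, exists2 e, (e0 <= e)%N & splits (phi charR e z).
  move=> zP e0; apply: contrapT => z_nonsplit; apply: zP; exists e0 => e e0e.
  by rewrite AE => z_split; apply: z_nonsplit; exists e.
rewrite inE => -[e0 xyA]; apply/orP; rewrite !inE.
apply: contrapT => /not_orP[/splits_of_notP/(_ e0)[e e0e x_split]].
(* The choice of [e] already gives [e0 <= e + e'], so the lower bound 0 is enough for [e']. *)
move=> /splits_of_notP/(_ 0%N)[e' _ y_split].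
have : A_ charR u (e + e') (x * y).
  by apply: xyA; apply: leq_trans (leq_addr _ _).
by rewrite AE; apply; apply: splits_phiM.
Qed.
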